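(* For any valley-free range map $\delta$, the unital associative algebra $(\mathbf{Cl}_\delta,\cdot,\mathds{1})$ is isomorphic to $\mathbb{K}\langle\mathbb{A}_{\mathcal{P}_\delta}\rangle/\mathcal{R}_\delta$, where $\mathcal{R}_\delta$ is the subspace (a two-sided ideal) of $\mathbb{K}\langle\mathbb{A}_{\mathcal{P}_\delta}\rangle$ defined as the linear span of the set $$\{a_{u^{(1)}}\cdots a_{u^{(k)}}:k\geq1,\ u^{(i)}\in\mathcal{P}_\delta\text{ for all }1\leq i\leq k,\text{ and }u^{(1)}\cdots u^{(k)}\notin\mathsf{Cl}_\delta\}.$$
   Context: $\mathbb{K}$ is a field of characteristic zero, $\mathbb{N}=\{0,1,2,\dots\}$. A range map is a map $\delta:\mathbb{N}\setminus\{0\}\to\mathbb{N}$; it is valley-free if there are no $1\leq i_1<i_2<i_3$ with $\delta(i_1)>\delta(i_2)<\delta(i_3)$. A $\delta$-cliff is a finite word $u=u_1\cdots u_n$ of nonnegative integers with $u_i\leq\delta(i)$ for all $i$; $\mathsf{Cl}_\delta$ is the set of all of them, including the empty word $\epsilon$. $\mathbf{Cl}_\delta$ is the $\mathbb{K}$-vector space with basis $\{\mathsf{F}_u:u\in\mathsf{Cl}_\delta\}$. For a word $v\in\mathbb{N}^n$, $\mathrm{r}_\delta(v)_i:=\min\{v_i,\delta(i)\}$. The product is the bilinear map $\mathsf{F}_u\cdot\mathsf{F}_v=\sum_{v'}\mathsf{F}_{uv'}$, summed over all words $v'\in\mathbb{N}^{|v|}$ such that $\mathrm{r}_\delta(v')=v$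 and $uv'\in\mathsf{Cl}_\delta$ ($uv'$ is the concatenation). The unit $\mathds{1}:\mathbb{K}\to\mathbf{Cl}_\delta$ sends $1$ to $\mathsf{F}_\epsilon$. For valley-free $\delta$ this is a unital associative algebra. A nonempty $\delta$-cliff $u$ is $\delta$-prime if $u=vw$ (concatenation) with $v,w\in\mathsf{Cl}_\delta$ implies $v=\epsilon$ or $w=\epsilon$. $\mathcal{P}_\delta$ is the set of $\delta$-prime $\delta$-cliffs. $\mathbb{A}_{\mathcal{P}_\delta}=\{a_u:u\in\mathcal{P}_\delta\}$ is a set of noncommuting variables and $\mathbb{K}\langle\mathbb{A}_{\mathcal{P}_\delta}\rangle$ is the free unital associative algebra on it. $u^{(1)}\cdots u^{(k)}$ denotes the concatenated word. *)

(* Defs.v *)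
From HB Require Import structures.
From mathcomp Require Import all_boot all_order all_algebra.
From mathcomp Require Import generic_quotient ring_quotient.
From mathcomp Require Import finmap boolp.
From mathcomp.multinomials Require Import monalg.

Set Implicit Arguments.
Unset Strict Implicit.
Unset Printing Implicit Defensive.

Import GRing.Theory.
Local Open Scope ring_scope.

Section LinearSpan.
Context {K : nzRingType} {V : lmodType K}.

Definition linear_span (S : V -> Prop) (x : V) : Prop :=
  exists2 s : seq (K * V),
    forall p, p \in s -> S p.2 & x = \sum_(p <- s) p.1 *: p.2.

Lemma linear_span0 S : linear_span S 0.
Proof. by exists [::] => //; rewrite big_nil. Qed.

Lemma linear_spanD S x y :
  linear_span S x -> linear_span S y -> linear_span S (x + y).
Proof.
move=> [s hs ->] [t ht ->]; exists (s ++ t); last by rewrite big_cat.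
by move=> p; rewrite mem_cat => /orP[/hs|/ht].
Qed.

Lemma linear_spanZ S c x : linear_span S x -> linear_span S (c *: x).
Proof.
move=> [s hs ->]; exists [seq (c * p.1, p.2) | p <- s].
  by move=> p /mapP[q /hs hq ->].
by rewrite big_map scaler_sumr; apply: eq_bigr => p _; rewrite scalerA.
Qed.

Lemma linear_span_ind S (P : V -> Prop) :
    P 0 -> (forall x y, P x -> P y -> P (x + y)) ->
    (forall c x, S x -> P (c *: x)) ->
  forall x, linear_span S x -> P x.
Proof.
move=> P0 PD PZ x [s hs ->]; rewrite big_seq.
by elim/big_ind: _ => // p /hs; apply: PZ.
Qed.

End LinearSpan.

(* The ideals of ring_quotient are one-sided, with a ring quotient only in    *)
(* the commutative case; the following is the noncommutative counterpart.     *)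
HB.mixin Record isTwoSidedIdeal (R : nzRingType) (S : R -> bool) := {
  ideal_neq1 : 1 \notin S;
  ideal_mulr : forall a, {in S, forall u, a * u \in S};
  ideal_mull : forall a, {in S, forall u, u * a \in S}
}.

#[short(type="twoSidedIdeal")]
HB.structure Definition TwoSidedIdeal (R : nzRingType) :=
  {S of GRing.ZmodClosed R S & isTwoSidedIdeal R S}.

Section QuotientAlgebra.
Local Open Scope quotient_scope.
Variables (K : nzRingType) (A : algType K) (I : twoSidedIdeal A).

Definition quot_alg : Type := Quotient.quot I.
HB.instance Definition _ := GRing.Zmodule.on quot_alg.
HB.instance Definition _ := EqQuotient.on quot_alg.

Definition quot_pi (x : A) : quot_alg := \pi_(Quotient.quot I) x.
Definition quot_repr (x : quot_alg) : A := repr (x : Quotient.quot I).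

Lemma quot_reprK : cancel quot_repr quot_pi.
Proof. exact: reprK. Qed.

Lemma quot_piE x y : (quot_pi x == quot_pi y) = (x - y \in I).
Proof. by rewrite /quot_pi Quotient.idealrBE. Qed.

Lemma quot_pi_eq x y : x - y \in I -> quot_pi x = quot_pi y.
Proof. by rewrite -quot_piE => /eqP. Qed.

Lemma quot_repr_pi x : quot_repr (quot_pi x) - x \in I.
Proof. by rewrite -quot_piE quot_reprK. Qed.

Lemma quot_piD x y : quot_pi (x + y) = quot_pi x + quot_pi y.
Proof. exact: (raddfD (\pi_(Quotient.quot I))). Qed.

Lemma quot_pi0 : quot_pi 0 = 0.
Proof. exact: (raddf0 (\pi_(Quotient.quot I))). Qed.

Definition quot_one : quot_alg := quot_pi 1.
Definition quot_mul (x y : quot_alg) : quot_alg :=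
  quot_pi (quot_repr x * quot_repr y).
Definition quot_scale (k : K) (x : quot_alg) : quot_alg :=
  quot_pi (k *: quot_repr x).

Lemma quot_piM x y : quot_pi (x * y) = quot_mul (quot_pi x) (quot_pi y).
Proof.
apply/esym/quot_pi_eq; set x' := quot_repr _; set y' := quot_repr _.
have -> : x' * y' - x * y = (x' - x) * y' + x * (y' - y).
  by rewrite mulrBl mulrBr addrA subrK.
by apply: rpredD; [apply: ideal_mull|apply: ideal_mulr]; apply: quot_repr_pi.
Qed.

Lemma quot_piZ k x : quot_pi (k *: x) = quot_scale k (quot_pi x).
Proof.
apply/esym/quot_pi_eq; rewrite -scalerBr -mulr_algl.
by apply: ideal_mulr; apply: quot_repr_pi.
Qed.

Lemma quot_mulA : associative quot_mul.
Proof.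
move=> x y z; rewrite -[x]quot_reprK -[y]quot_reprK -[z]quot_reprK.
by rewrite -!quot_piM mulrA.
Qed.

Lemma quot_mul1 : left_id quot_one quot_mul.
Proof. by move=> x; rewrite -[x]quot_reprK -quot_piM mul1r. Qed.

Lemma quot_mulx1 : right_id quot_one quot_mul.
Proof. by move=> x; rewrite -[x]quot_reprK -quot_piM mulr1. Qed.

Lemma quot_mulDl : left_distributive quot_mul +%R.
Proof.
move=> x y z; rewrite -[x]quot_reprK -[y]quot_reprK -[z]quot_reprK.
by rewrite -quot_piD -!quot_piM -quot_piD mulrDl.
Qed.

Lemma quot_mulDr : right_distributive quot_mul +%R.
Proof.
move=> x y z; rewrite -[x]quot_reprK -[y]quot_reprK -[z]quot_reprK.
by rewrite -quot_piD -!quot_piM -quot_piD mulrDr.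
Qed.

Lemma quot_one_neq0 : quot_one != 0.
Proof. by rewrite -quot_pi0 quot_piE subr0 ideal_neq1. Qed.

HB.instance Definition _ := GRing.Zmodule_isNzRing.Build quot_alg
  quot_mulA quot_mul1 quot_mulx1 quot_mulDl quot_mulDr quot_one_neq0.

Lemma quot_scaleA a b x : quot_scale a (quot_scale b x) = quot_scale (a * b) x.
Proof. by rewrite -[x]quot_reprK -!quot_piZ scalerA. Qed.

Lemma quot_scale1 : left_id 1 quot_scale.
Proof. by move=> x; rewrite -[x]quot_reprK -quot_piZ scale1r. Qed.

Lemma quot_scaleDr : right_distributive quot_scale +%R.
Proof.
move=> a x y; rewrite -[x]quot_reprK -[y]quot_reprK.
by rewrite -quot_piD -!quot_piZ -quot_piD scalerDr.
Qed.

Lemma quot_scaleDl x : {morph quot_scale^~ x : a b / a + b}.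
Proof.
by move=> a b /=; rewrite -[x]quot_reprK -!quot_piZ -quot_piD scalerDl.
Qed.

HB.instance Definition _ := GRing.Zmodule_isLmodule.Build K quot_alg
  quot_scaleA quot_scale1 quot_scaleDr quot_scaleDl.

Lemma quot_scaleAl a (x y : quot_alg) : a *: (x * y) = a *: x * y.
Proof.
rewrite -[x]quot_reprK -[y]quot_reprK.
by rewrite /GRing.scale/= /GRing.mul/= -!(quot_piM, quot_piZ) scalerAl.
Qed.

HB.instance Definition _ := GRing.Lmodule_isLalgebra.Build K quot_alg
  quot_scaleAl.

Lemma quot_scaleAr a (x y : quot_alg) : a *: (x * y) = x * (a *: y).
Proof.
rewrite -[x]quot_reprK -[y]quot_reprK.
by rewrite /GRing.scale/= /GRing.mul/= -!(quot_piM, quot_piZ) scalerAr.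
Qed.

HB.instance Definition _ := GRing.Lalgebra_isAlgebra.Build K quot_alg
  quot_scaleAr.

Lemma quot_pi_zmod_morphism : zmod_morphism quot_pi.
Proof. exact: (raddfB (\pi_(Quotient.quot I))). Qed.
HB.instance Definition _ := GRing.isZmodMorphism.Build A quot_alg quot_pi
  quot_pi_zmod_morphism.

Lemma quot_pi_monoid_morphism : monoid_morphism quot_pi.
Proof. by split=> // x y; rewrite quot_piM. Qed.
HB.instance Definition _ := GRing.isMonoidMorphism.Build A quot_alg quot_pi
  quot_pi_monoid_morphism.

HB.instance Definition _ := GRing.isScalable.Build K A quot_alg *:%R quot_pi
  quot_piZ.

End QuotientAlgebra.

Section FreeAlgebra.
Variables (K : comNzRingType) (A : choiceType).

Definition free_alg : Type := {malg K[{fmonom A}]}.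
HB.instance Definition _ := GRing.Lalgebra.on free_alg.

Lemma malg_scaleAr (M : monomType) k (x y : {malg K[M]}) : k *: (x * y) = x * (k *: y).
Proof.
apply/malgP => m; rewrite mcoeffZ mcoeffMl.
rewrite (mcoeffMlw m (fsubset_refl (msupp x)) (msuppZ_le k y)).
rewrite mulr_sumr; apply: eq_bigr => m1 _.
rewrite mulr_sumr; apply: eq_bigr => m2 _.
by rewrite mcoeffZ mulrnAr mulrCA.
Qed.

HB.instance Definition _ := GRing.Lalgebra_isAlgebra.Build K free_alg
  (@malg_scaleAr {fmonom A}).

Definition free_var (a : A) : free_alg := << fmu a >>.

Definition free_word (s : seq A) : free_alg := \prod_(a <- s) free_var a.

Lemma free_word_cat s t : free_word (s ++ t) = free_word s * free_word t.
Proof. exact: big_cat. Qed.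

Lemma free_wordE s : free_word s = << FMonom s >>.
Proof.
elim: s => [|a s IH].
  by rewrite /free_word big_nil /GRing.one/= /fgone /mone/= fmoneE.
rewrite -cat1s free_word_cat IH {1}/free_word big_seq1.
by rewrite [LHS]fgmulUU mulr1 /mmul/= fmmulE fmuE.
Qed.

End FreeAlgebra.

Section Cliffs.

(* A range map is a function on the positive integers; delta 0 is a junk      *)
(* value that no definition below looks at. The letter u_i of a word          *)
(* u = u_1 ... u_n is nth 0 u i.-1.                                           *)
Variable delta : nat -> nat.

Definition valley_free : Prop :=
  forall i1 i2 i3 : nat, (1 <= i1)%N -> (i1 < i2)%N -> (i2 < i3)%N ->
    ~ ((delta i1 > delta i2)%N /\ (delta i2 < delta i3)%N).

Definition is_cliff (u : seq nat) : bool :=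
  all (fun i => nth 0 u i <= delta i.+1)%N (iota 0 (size u)).

Record cliff := Cliff { cliff_word :> seq nat; cliffP : is_cliff cliff_word }.

HB.instance Definition _ := [isSub for cliff_word].
HB.instance Definition _ := [Choice of cliff by <:].

Definition trunc (v : seq nat) : seq nat :=
  mkseq (fun i => minn (nth 0 v i) (delta i.+1)) (size v).

Definition is_prime (u : cliff) : Prop :=
  u <> [::] :> seq nat /\
  forall v w : cliff, u = v ++ w :> seq nat ->
    v = [::] :> seq nat \/ w = [::] :> seq nat.

Record prime_cliff :=
  PrimeCliff { prime_val :> cliff; prime_cliffP : `[< is_prime prime_val >] }.

HB.instance Definition _ := [isSub for prime_val].
HB.instance Definition _ := [Choice of prime_cliff by <:].

Definition concat_word (s : seq prime_cliff) : seq nat :=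
  flatten [seq cliff_word (prime_val p) | p <- s].

Lemma is_cliffP (u : seq nat) :
  reflect (forall i, i < size u -> nth 0 u i <= delta i.+1)%N (is_cliff u).
Proof.
apply: (iffP allP) => h i; last by rewrite mem_iota => /= /h.
by move=> lti; apply: h; rewrite mem_iota.
Qed.

Lemma is_cliff_nil : is_cliff [::]. Proof. by []. Qed.
Definition cliff_nil := Cliff is_cliff_nil.

Lemma is_cliff_prefix u v : is_cliff (u ++ v) -> is_cliff u.
Proof.
move=> /is_cliffP h; apply/is_cliffP => i lti.
by have := h i; rewrite nth_cat lti size_cat => -> //; rewrite ltn_addr.
Qed.

Lemma is_cliff_take k (u : cliff) : is_cliff (take k u).
Proof. by apply: (@is_cliff_prefix _ (drop k u)); rewrite cat_take_drop cliffP. Qed.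
Definition cliff_take k u := Cliff (is_cliff_take k u).

Lemma size_trunc v : size (trunc v) = size v.
Proof. exact: size_mkseq. Qed.

Lemma nth_trunc v i : nth 0%N (trunc v) i = minn (nth 0%N v i) (delta i.+1).
Proof.
have [lti|lei] := ltnP i (size v); first by rewrite nth_mkseq.
by rewrite !nth_default ?min0n ?size_trunc.
Qed.

Lemma is_cliff_trunc v : is_cliff (trunc v).
Proof. by apply/is_cliffP => i _; rewrite nth_trunc geq_minr. Qed.
Definition cliff_trunc v := Cliff (is_cliff_trunc v).

Lemma take_trunc k v : take k (trunc v) = trunc (take k v).
Proof.
apply: (@eq_from_nth _ 0%N) => [|i]; rewrite ?size_take_min ?size_trunc.
  by rewrite size_take_min.
rewrite leq_min => /andP[ltik _]; rewrite nth_take // !nth_trunc.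
by rewrite nth_take.
Qed.

Lemma trunc_cliff (u : cliff) : trunc u = u.
Proof.
apply: (@eq_from_nth _ 0%N) => [|i]; rewrite size_trunc // nth_trunc => lti.
by apply/minn_idPl; apply: (is_cliffP _ (cliffP u)).
Qed.

Lemma valley_freeP : valley_free -> forall i j k, (1 <= i)%N ->
  (i <= j)%N -> (j <= k)%N -> (minn (delta i) (delta k) <= delta j)%N.
Proof.
move=> vf i j k i1; rewrite leq_eqVlt => /orP[/eqP->|ij]; first by rewrite geq_minl.
rewrite leq_eqVlt => /orP[/eqP->|jk]; first by rewrite geq_minr.
rewrite leqNgt; apply/negP; rewrite leq_min => /andP[h1 h2].
exact: (vf i j k).
Qed.

Lemma is_cliff_catr (s : seq cliff) (x : seq nat) : valley_free ->
  let y := flatten [seq cliff_word p | p <- s] in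
  is_cliff (x ++ y) -> is_cliff y.
Proof.
move=> vf /=; elim/last_ind: s => [//|s c IH].
rewrite map_rcons flatten_rcons => h; move: (h); rewrite catA => /is_cliff_prefix.
move: h; set y := flatten _ => /is_cliffP h /IH/is_cliffP hy.
apply/is_cliffP => i; rewrite size_cat nth_cat.
case: (ltnP i (size y)) => [lti _|leyi lti]; first exact: hy.
have lt2 : (i - size y < size c)%N by rewrite ltn_subLR.
have := h (size x + i)%N; rewrite !size_cat ltn_add2l => /(_ lti).
rewrite nth_cat ltnNge leq_addr /= addKn nth_cat ltnNge leyi /= => h1.
have h2 := is_cliffP _ (cliffP c) _ lt2.
apply: (leq_trans _ (@valley_freeP vf (i - size y).+1 i.+1 (size x + i).+1 _ _ _)).
- by rewrite leq_min h1 h2.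
- by [].
- by rewrite ltnS leq_subr.
- by rewrite ltnS leq_addl.
Qed.

Lemma trunc_drop_trunc (w : cliff) j i : valley_free ->
  trunc (drop i (trunc (drop j w))) = trunc (drop (j + i) w).
Proof.
move=> vf; have szE : size (drop i (trunc (drop j w))) = size (drop (j + i) w).
  by rewrite !size_drop size_trunc size_drop subnDA.
apply: (@eq_from_nth _ 0%N) => [|n]; rewrite !size_trunc //.
rewrite szE size_drop !(nth_trunc, nth_drop) ltn_subRL addnA => ltn.
rewrite -minnA [minn (delta (i + n).+1) _]minnC minnA; apply/minn_idPl.
apply: leq_trans (@valley_freeP vf n.+1 (i + n).+1 (j + i + n).+1 _ _ _) => //.
- rewrite leq_min geq_minr (leq_trans (geq_minl _ _)) //.
  exact: (is_cliffP _ (cliffP w)).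
- by rewrite ltnS leq_addl.
- by rewrite ltnS -addnA leq_addl.
Qed.

End Cliffs.

Section CliffBasisProduct.
Variables (K : fieldType) (delta : nat -> nat).
Local Notation C := (cliff delta).
Local Notation V := {malg K[C]}.

(* F u is the basis vector F_u if the word u is a cliff, and 0 otherwise.     *)
Definition F (u : seq nat) : V :=
  if insub u is Some c then << (c : C) >> else 0.

(* Strict upper bound on the letters of all cliffs of length at most n.       *)
Definition letter_bound (n : nat) : nat := (\max_(i < n) delta i.+1).+1.

(* F_u . F_v: the letters of v' are drawn from a finite set large enough to   *)
(* contain those of every v' such that u ++ v' is a cliff.                    *)
Definition F_mul (u v : C) : V :=
  \sum_(v' : (size v).-tuple 'I_(letter_bound (size u + size v)) |
        (trunc delta (map val v') == v) && is_cliff delta (u ++ map val v'))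
    F (u ++ map val v').

End CliffBasisProduct.

(* Locked so that unification does not unfold products into double sums.      *)
HB.lock Definition cliff_mul (K : fieldType) (delta : nat -> nat)
    (x y : {malg K[cliff delta]}) : {malg K[cliff delta]} :=
  \sum_(u <- msupp x) \sum_(v <- msupp y) (x@_u * y@_v) *: F_mul K u v.

Section CliffProduct.
Variables (K : fieldType) (delta : nat -> nat).
Local Notation C := (cliff delta).
Local Notation V := {malg K[C]}.
Local Notation cliff_mul := (@cliff_mul K delta).
Local Notation F := (F K delta).

Lemma mcoeffF u (w : C) : (F u)@_w = (val w == u)%:R.
Proof.
rewrite /F; case: insubP => [c _ <-|nc].
  by rewrite mcoeffU eq_sym val_eqE.
rewrite mcoeff0; case: eqP => // wu.
by move: nc; rewrite -wu (cliffP w).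
Qed.

(* The sum defining F_mul misses no term.                                     *)
Lemma mcoeff_F_mul (u v w : C) : (F_mul K u v)@_w =
  [&& size w == (size u + size v)%N, take (size u) w == u
    & trunc delta (drop (size u) w) == v]%:R.
Proof.
rewrite /F_mul raddf_sum /=; set B := letter_bound _ _.
case: (boolP [&& _, _ & _]) => [/and3P[/eqP szw /eqP tw /eqP dw]|nw]; last first.
  rewrite big1 // => t /andP[/eqP h1 h2]; rewrite mcoeffF; case: eqP => // wE.
  case/negP: nw; rewrite wE size_cat size_map size_tuple eqxx /=.
  by rewrite take_size_cat // drop_size_cat // h1 !eqxx.
have szd : size (drop (size u) w) = size v by rewrite size_drop szw addKn.
have ltB i : (i < size w)%N -> (nth 0 w i < B)%N.
  move=> lti; rewrite ltnS (leq_trans (is_cliffP _ _ (cliffP w) _ lti)) //.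
  rewrite szw in lti.
  exact: (leq_bigmax (F := fun i : 'I__ => delta i.+1) (Ordinal lti)).
have szt : size [seq (inord k : 'I_B) | k <- drop (size u) w] == size v.
  by rewrite size_map szd.
have tE : map val (Tuple szt) = drop (size u) w.
  rewrite /= -map_comp -[RHS]map_id; apply/eq_in_map => k /(nthP 0%N)[i].
  rewrite size_drop ltn_subRL => lti <-; rewrite nth_drop /= inordK //.
  exact: ltB.
have wE : u ++ map val (Tuple szt) = w by rewrite tE -[X in X ++ _]tw cat_take_drop.
rewrite (bigD1 (Tuple szt)) /=; last by rewrite wE (cliffP w) andbT tE dw.
rewrite mcoeffF wE eqxx big1 ?addr0 // => t /andP[_ nt].
rewrite mcoeffF; case: eqP => // wE'; case/negP: nt; apply/eqP/val_inj.
by apply: (inj_map val_inj); rewrite [RHS]tE wE' drop_size_cat.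
Qed.

Lemma cliff_mulFF (u v : C) : cliff_mul << u >> << v >> = F_mul K u v.
Proof.
by rewrite unlock !msuppU !oner_eq0 !big_seq_fset1 !mcoeffUU mulr1 scale1r.
Qed.

Lemma mcoeff_F_mul_sum (u v w : C) : (F_mul K u v)@_w =
  \sum_(k < (size w).+1)
    (u == cliff_take k w)%:R * (v == cliff_trunc delta (drop k w))%:R.
Proof.
rewrite mcoeff_F_mul; have [szw|szw] := ltnP (size w) (size u).
  rewrite ltn_eqF ?ltn_addr // big1 // => k _.
  rewrite -val_eqE /=; case: eqP => [uE|]; last by rewrite mul0r.
  have lek : (k <= size w)%N by rewrite -ltnS.
  by rewrite uE size_takel // ltnNge lek in szw.
rewrite (bigD1 (Ordinal (szw : (size u < (size w).+1)%N))) //= [X in _ + X]big1.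
  rewrite addr0 -!val_eqE /= -natrM mulnb; congr (nat_of_bool _)%:R.
  apply/and3P/andP => [[_ /eqP-> /eqP->]//|[/eqP uE /eqP vE]].
  by rewrite -uE -vE !eqxx vE size_trunc size_drop subnKC.
move=> k nk; rewrite -!val_eqE /=; case: eqP => [uE|]; last by rewrite mul0r.
by case/negP: nk; rewrite -val_eqE /= uE size_takel // -ltnS.
Qed.

Lemma mcoeff_sum_eq (x : V) (t : C) :
  \sum_(u <- msupp x) x@_u * (u == t)%:R = x@_t.
Proof.
rewrite [in RHS](monalgE x) raddf_sum /=; apply: eq_bigr => u _.
by rewrite mcoeffU mulr_natr.
Qed.

Lemma mcoeff_cliff_mul x y (w : C) : (cliff_mul x y)@_w =
  \sum_(k < (size w).+1)
    x@_(cliff_take k w) * y@_(cliff_trunc delta (drop k w)).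
Proof.
rewrite unlock raddf_sum /=.
under eq_bigr => u _.
  rewrite raddf_sum /=.
  under eq_bigr => v _ do rewrite mcoeffZ mcoeff_F_mul_sum mulr_sumr.
  rewrite exchange_big /=; over.
rewrite exchange_big /=; apply: eq_bigr => k _.
rewrite -(mcoeff_sum_eq x) -(mcoeff_sum_eq y) mulr_suml.
apply: eq_bigr => u _; rewrite mulr_sumr; apply: eq_bigr => v _.
by rewrite mulrACA.
Qed.

Lemma exchange_triangle (n : nat) (G : nat -> nat -> K) :
  \sum_(j < n.+1) \sum_(i < (n - j).+1) G j (j + i)%N =
  \sum_(k < n.+1) \sum_(j < k.+1) G j k.
Proof.
transitivity (\sum_(j < n.+1) \sum_(k < n.+1 | (j <= k)%N) G j k).
  apply: eq_bigr => j _; have lej : (j <= n)%N by rewrite -ltnS.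
  rewrite -(big_mkord (fun k => j <= k)%N (G j)).
  have -> : \sum_(0 <= k < n.+1 | (j <= k)%N) G j k =
            \sum_(j <= k < n.+1) G j k by rewrite [RHS](big_nat_widenl _ 0%N).
  have := big_addn 0 n.+1 j xpredT (G j).
  rewrite add0n => ->; rewrite subSn // big_mkord.
  by apply: eq_bigr => i _; rewrite addnC.
rewrite (exchange_big_dep xpredT) //=; apply: eq_bigr => k _.
rewrite -(big_mkord (fun j => j <= k)%N (G ^~ k)).
rewrite -(big_mkord xpredT (G ^~ k)) [RHS](big_nat_widen _ _ n.+1) //.
Qed.

Lemma cliff_mulA : valley_free delta -> associative cliff_mul.
Proof.
move=> vf x y z; apply/malgP => w.
rewrite (mcoeff_cliff_mul x (cliff_mul y z)) (mcoeff_cliff_mul (cliff_mul x y) z).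
pose G j k := x@_(cliff_take j w) *
  y@_(cliff_trunc delta (drop j (take k w))) *
  z@_(cliff_trunc delta (drop k w)).
transitivity (\sum_(j < (size w).+1) \sum_(i < (size w - j).+1) G j (j + i)%N).
  apply: eq_bigr => j _; rewrite mcoeff_cliff_mul mulr_sumr /=.
  rewrite size_trunc size_drop; apply: eq_bigr => i _; rewrite mulrA /G.
  congr (_ * mcoeff _ y * mcoeff _ z); apply: val_inj => /=; last exact: trunc_drop_trunc.
  by rewrite take_trunc take_drop addnC.
rewrite exchange_triangle; apply: eq_bigr => k _.
rewrite mcoeff_cliff_mul mulr_suml /= size_takel; last by rewrite -ltnS.
apply: eq_bigr => j _; congr (mcoeff _ x * _ * _); apply: val_inj => /=.
by rewrite take_takel // -ltnS.
Qed.

Lemma cliff_mul1 : left_id << cliff_nil delta >> cliff_mul.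
Proof.
move=> x; apply/malgP => w; rewrite mcoeff_cliff_mul big_ord_recl big1 => [|i _].
  rewrite addr0 mcoeffU -val_eqE /= take0 eqxx mul1r.
  by congr (mcoeff _ x); apply: val_inj; rewrite /= drop0 trunc_cliff.
rewrite mcoeffU -val_eqE /= eq_sym -size_eq0 size_takel ?mul0r //.
Qed.

Lemma cliff_mulx1 : right_id << cliff_nil delta >> cliff_mul.
Proof.
move=> x; apply/malgP => w; rewrite mcoeff_cliff_mul big_ord_recr big1 => [|i _] /=.
  rewrite add0r mcoeffU -val_eqE /= drop_size eqxx mulr1.
  by congr (mcoeff _ x); apply: val_inj; rewrite /= take_size.
rewrite mcoeffU -val_eqE /= eq_sym -size_eq0 size_trunc size_drop subn_eq0.
by rewrite leqNgt (valP i) mulr0.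
Qed.

Lemma cliff_mulDl : left_distributive cliff_mul +%R.
Proof.
move=> x y z; apply/malgP => w; rewrite (mcoeffD w (cliff_mul x z)).
rewrite (mcoeff_cliff_mul (x + y)) (mcoeff_cliff_mul x) (mcoeff_cliff_mul y).
rewrite -big_split; apply: eq_bigr => k _.
by rewrite (mcoeffD (cliff_take k w)) mulrDl.
Qed.

Lemma cliff_mulDr : right_distributive cliff_mul +%R.
Proof.
move=> x y z; apply/malgP => w; rewrite (mcoeffD w (cliff_mul x y)).
rewrite (mcoeff_cliff_mul x (y + z)) (mcoeff_cliff_mul x y).
rewrite (mcoeff_cliff_mul x z) -big_split; apply: eq_bigr => k _.
by rewrite (mcoeffD (cliff_trunc delta (drop k w))) mulrDr.
Qed.

Lemma cliff_one_neq0 : << cliff_nil delta >> != 0 :> V.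
Proof. by rewrite monalgU_eq0 oner_eq0. Qed.

Lemma cliff_scaleAl a x y : a *: cliff_mul x y = cliff_mul (a *: x) y.
Proof.
apply/malgP => w; rewrite (mcoeffZ a (cliff_mul x y)) (mcoeff_cliff_mul x).
rewrite (mcoeff_cliff_mul (a *: x)) mulr_sumr.
by apply: eq_bigr => k _; rewrite (mcoeffZ a x) mulrA.
Qed.

Lemma cliff_scaleAr a x y : a *: cliff_mul x y = cliff_mul x (a *: y).
Proof.
apply/malgP => w; rewrite (mcoeffZ a (cliff_mul x y)) (mcoeff_cliff_mul x y).
rewrite (mcoeff_cliff_mul x (a *: y)) mulr_sumr.
by apply: eq_bigr => k _; rewrite (mcoeffZ a y) mulrCA.
Qed.

End CliffProduct.

Section CliffAlgebra.
Variables (K : fieldType) (delta : nat -> nat) (vf : valley_free delta).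

(* The proof vf is only needed for the algebra structure (associativity).     *)
Definition cliff_alg (_ : valley_free delta) : Type := {malg K[cliff delta]}.
Local Notation Cl := (cliff_alg vf).

HB.instance Definition _ := GRing.Lmodule.copy Cl {malg K[cliff delta]}.
HB.instance Definition _ := GRing.Zmodule_isNzRing.Build Cl
  (cliff_mulA vf) (@cliff_mul1 K delta) (@cliff_mulx1 K delta)
  (@cliff_mulDl K delta) (@cliff_mulDr K delta) (@cliff_one_neq0 K delta).
HB.instance Definition _ := GRing.Lmodule_isLalgebra.Build K Cl
  (@cliff_scaleAl K delta).
HB.instance Definition _ := GRing.Lalgebra_isAlgebra.Build K Cl
  (@cliff_scaleAr K delta).

End CliffAlgebra.

Section RelationIdeal.
Variables (K : fieldType) (delta : nat -> nat).
Local Notation P := (prime_cliff delta).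
Local Notation A := (free_alg K P).

Definition rel_gen (x : A) : Prop :=
  exists s : seq P,
    [/\ s <> [::], ~~ is_cliff delta (concat_word s) & x = free_word K s].

Definition rel_space (x : A) : bool := `[< linear_span rel_gen x >].

Lemma rel_space_zmod_closed : zmod_closed rel_space.
Proof.
split=> [|x y /asboolP hx /asboolP hy]; apply/asboolP.
  exact: linear_span0.
by apply: linear_spanD => //; rewrite -scaleN1r; apply: linear_spanZ.
Qed.

Lemma rel_space_neq1 : 1 \notin rel_space.
Proof.
apply/negP => /asboolP h; pose c1 (x : {malg K[{fmonom P}]}) := x@_mone.
suff: c1 1 = 0 by rewrite /c1 mcoeff1 eqxx => /eqP; rewrite oner_eq0.
move: h; apply: (@linear_span_ind K A rel_gen (fun x => c1 x = 0)).
- exact: mcoeff0.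
- by move=> x y hx hy; rewrite /c1 mcoeffD -/(c1 x) -/(c1 y) hx hy addr0.
move=> c x [s [s0 _ ->]]; rewrite /c1 mcoeffZ free_wordE mcoeffU -val_eqE /= fm1.
by case: eqP => // _; rewrite mulr0.
Qed.

Lemma free_alg_ind (Q : A -> Prop) :
    Q 0 -> (forall x y, Q x -> Q y -> Q (x + y)) ->
    (forall c s, Q (c *: free_word K s)) ->
  forall x, Q x.
Proof.
move=> Q0 QD QZ x; rewrite (monalgE x); elim/big_ind: _ => // m _.
have -> : << x@_m *g m >> = x@_m *: free_word K m; last exact: QZ.
apply/malgP => k; rewrite mcoeffZ free_wordE !mcoeffU mulr_natr.
by case: m.
Qed.

Lemma rel_space_mulr (vf : valley_free delta) :
  forall a, {in rel_space, forall u, a * u \in rel_space}.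
Proof.
move=> a u /asboolP hu; apply/asboolP.
move: u hu; apply: linear_span_ind => [|x y hx hy|c x [s [s0 ncl ->]]].
- by rewrite mulr0; apply: linear_span0.
- by rewrite mulrDr; apply: linear_spanD.
rewrite -scalerAr; apply: linear_spanZ.
move: a; apply: free_alg_ind => [|x1 x2 h1 h2|c1 t].
- by rewrite mul0r; apply: linear_span0.
- by rewrite mulrDl; apply: linear_spanD.
rewrite -scalerAl -free_word_cat.
exists [:: (c1, free_word K (t ++ s))]; last by rewrite big_seq1.
move=> p; rewrite inE => /eqP-> /=; exists (t ++ s); split=> //.
  by case: (t) s0.
apply: contra ncl; rewrite /concat_word map_cat flatten_cat.
have := @is_cliff_catr delta [seq prime_val p | p <- s] _ vf.
by rewrite -map_comp; apply.
Qed.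

Lemma rel_space_mull :
  forall a, {in rel_space, forall u, u * a \in rel_space}.
Proof.
move=> a u /asboolP hu; apply/asboolP.
move: u hu; apply: linear_span_ind => [|x y hx hy|c x [s [s0 ncl ->]]].
- by rewrite mul0r; apply: linear_span0.
- by rewrite mulrDl; apply: linear_spanD.
rewrite -scalerAl; apply: linear_spanZ.
move: a; apply: free_alg_ind => [|x1 x2 h1 h2|c1 t].
- by rewrite mulr0; apply: linear_span0.
- by rewrite mulrDr; apply: linear_spanD.
rewrite -scalerAr -free_word_cat.
exists [:: (c1, free_word K (s ++ t))]; last by rewrite big_seq1.
move=> p; rewrite inE => /eqP-> /=; exists (s ++ t); split=> //.
  by case: (s) s0.
apply: contra ncl; rewrite /concat_word map_cat flatten_cat.
exact: is_cliff_prefix.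
Qed.

Definition rel_ideal (vf : valley_free delta) : twoSidedIdeal A :=
  HB.pack_for (twoSidedIdeal A) rel_space
    (GRing.isZmodClosed.Build A rel_space rel_space_zmod_closed)
    (isTwoSidedIdeal.Build A rel_space
       rel_space_neq1 (rel_space_mulr vf) rel_space_mull).

End RelationIdeal.

(* Main.v *)
Require Import Defs.
From HB Require Import structures.
From mathcomp Require Import all_boot all_order all_algebra.
From mathcomp Require Import finmap boolp.
From mathcomp.multinomials Require Import monalg.

Set Implicit Arguments.
Unset Strict Implicit.
Unset Printing Implicit Defensive.

Import GRing.Theory.
Local Open Scope ring_scope.

(** The product [F_u . F_v] has many terms because truncation forgets
    letters.  It becomes monomial in another basis.  For a word [w], let
    [upper_sum w] be the sum of the [F_c] over the cliffs [c] of the length of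
    [w] that dominate [w] letter by letter.  Truncating at [delta] does not
    change whether a word dominates a given cliff [v]; hence the terms of
    [upper_sum u . upper_sum v] are the [F_c] with [c] a cliff dominating
    [u ++ v], each once, and the product is [upper_sum (u ++ v)]
    ([upper_sum_cat]).  This is zero when [u ++ v] is not a cliff, since a word
    dominated by a cliff is a cliff ([upper_sum_eq0]).  On cliffs,
    [upper_sum c] is [F_c] plus terms of larger letter sum, so these elements
    form a basis.

    Every cliff is a concatenation of primes ([prime_factorization]), and for a
    valley-free [delta] in one way only ([concat_word_inj]), because
    valley-freeness lets one drop the first factors of a factorized cliff
    ([prime_factor_suffix]).

    Therefore the algebra morphism that sends [a_u] to [upper_sum u] kills the
    monomials whose word is not a cliff, which span the relation space, and
    maps the other monomials bijectively onto a basis.  It is surjective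
    ([prime_lift_surj]) with kernel the relation ideal ([prime_lift_ker]), and
    the first isomorphism theorem applies. *)

(** * The first isomorphism theorem for noncommutative algebras *)

Section FirstIsomorphism.
Variables (K : nzRingType) (A B : algType K) (I : twoSidedIdeal A).

(** The isomorphism is taken from [B] to the quotient: it lifts [y] to any
    preimage under [g], and the kernel condition makes its class independent of
    the choice, whence all the morphism laws. *)
Lemma first_isomorphism (g : {lrmorphism A -> B}) :
    (forall y, exists x, g x = y) -> (forall x, (g x == 0) = (x \in I)) ->
  exists f : {lrmorphism B -> quot_alg I}, bijective f.
Proof.
move=> /choice[h gh] kerg.
have piE x y : g x = g y -> quot_pi I x = quot_pi I y.
  by move=> gxy; apply: quot_pi_eq; rewrite -kerg rmorphB /= gxy subrr.
pose f y := quot_pi I (h y).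
have fB : zmod_morphism f.
  by move=> x y; rewrite /f -raddfB; apply: piE; rewrite raddfB /= !gh.
have fM : monoid_morphism f.
  by split=> [|x y]; rewrite /f -?rmorphM -?(rmorph1 (quot_pi I)); apply: piE;
     rewrite ?rmorphM ?rmorph1 /= !gh.
have fZ : scalable f.
  by move=> k x; rewrite /f -linearZ; apply: piE; rewrite linearZ /= !gh.
exists (HB.pack_for {lrmorphism B -> quot_alg I} f
  (GRing.isZmodMorphism.Build _ _ f fB) (GRing.isMonoidMorphism.Build _ _ f fM)
  (GRing.isScalable.Build _ _ _ _ f fZ)).
exists (fun q => g (quot_repr q)) => [y|q] /=; rewrite /f.
  rewrite -[RHS]gh; apply/eqP; rewrite -subr_eq0 -rmorphB kerg.
  exact: quot_repr_pi.
by rewrite -[RHS]quot_reprK; apply: piE; rewrite gh.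
Qed.

End FirstIsomorphism.

(** * The universal property of the free algebra *)

Section FreeLift.
Variables (K : comNzRingType) (A : choiceType) (B : algType K) (e : A -> B).

Definition eval_word (m : {fmonom A}) : B := \prod_(a <- (m : seq A)) e a.

Lemma eval_word_mmorphism : mmorphism eval_word.
Proof.
by split=> [m n|]; rewrite /eval_word ?fmM ?fm1 ?big_cat ?big_nil.
Qed.
HB.instance Definition _ :=
  isMultiplicative.Build {fmonom A} B eval_word eval_word_mmorphism.

Definition free_lift (x : free_alg K A) : B := mmap (in_alg B) eval_word x.

Lemma free_liftE x :
  free_lift x = \sum_(m <- msupp x) x@_m *: \prod_(a <- (m : seq A)) e a.
Proof. by apply: eq_bigr => m _; rewrite mulr_algl. Qed.

Lemma free_lift_free_word s : free_lift (free_word K s) = \prod_(a <- s) e a.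
Proof. by rewrite free_wordE /free_lift mmapU /= scale1r mul1r. Qed.

Lemma free_lift_zmod_morphism : zmod_morphism free_lift.
Proof. exact: mmap_is_additive. Qed.
HB.instance Definition _ := GRing.isZmodMorphism.Build (free_alg K A) B
  free_lift free_lift_zmod_morphism.

Lemma free_lift_monoid_morphism : monoid_morphism free_lift.
Proof.
have [|fM f1] :=
  @commr_mmap_is_multiplicative {fmonom A} K B (in_alg B) eval_word.
  by move=> x m m'; rewrite /GRing.comm /= mulr_algl mulr_algr.
by split.
Qed.
HB.instance Definition _ := GRing.isMonoidMorphism.Build (free_alg K A) B
  free_lift free_lift_monoid_morphism.

Lemma free_lift_scalable : scalable free_lift.
Proof. by move=> k x; rewrite /free_lift mmapZ /= mulr_algl. Qed.
HB.instance Definition _ := GRing.isScalable.Build K (free_alg K A) B *:%R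
  free_lift free_lift_scalable.

End FreeLift.

(** * The letterwise order on words *)

Section LetterwiseOrder.
Implicit Types u v w : seq nat.

Lemma all2_leqP u v :
  reflect (size u = size v /\ forall i, (nth 0 u i <= nth 0 v i)%N)
          (all2 leq u v).
Proof.
apply: (iffP idP) => [|[]].
  elim: u v => [|a u IH] [|b v] //= /andP[ab /IH[-> h]].
  by split=> // -[|i] /=.
elim: u v => [|a u IH] [|b v] //= [/IH{}IH] h.
by rewrite (h 0%N) IH // => i; apply: (h i.+1).
Qed.

Lemma all2_leq_size u v : all2 leq u v -> size u = size v.
Proof. by case/all2_leqP. Qed.

Lemma all2_leq_refl u : all2 leq u u.
Proof. by apply/all2_leqP. Qed.

Lemma all2_leq_cat u v w : all2 leq (u ++ v) w =
  all2 leq u (take (size u) w) && all2 leq v (drop (size u) w).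
Proof.
by elim: u w => [|a u IH] [|b w] //=; rewrite ?take0 ?IH ?andbA.
Qed.

Lemma leq_sumn u v : all2 leq u v -> (sumn u <= sumn v)%N.
Proof.
by elim: u v => [|a u IH] [|b v] //= /andP[ab /IH]; apply: leq_add.
Qed.

Lemma ltn_sumn u v : all2 leq u v -> u != v -> (sumn u < sumn v)%N.
Proof.
elim: u v => [|a u IH] [|b v] //= /andP[ab uv]; rewrite eqseq_cons.
have [<-|neqab _] /= := eqVneq a b; first by rewrite ltn_add2l; apply: IH.
by rewrite -addSn leq_add ?leq_sumn // ltn_neqAle neqab.
Qed.

End LetterwiseOrder.

(** * Cliffs as a lower set of the letterwise order *)

Section CliffOrder.
Variable delta : nat -> nat.
Implicit Types (u v w : seq nat).

Definition max_cliff_word n : seq nat := mkseq (fun i => delta i.+1) n.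

Lemma is_cliffE u : is_cliff delta u = all2 leq u (max_cliff_word (size u)).
Proof.
apply/is_cliffP/all2_leqP => [h|[_ h] i lti]; last first.
  by have := h i; rewrite nth_mkseq.
rewrite size_mkseq; split=> // i; have [lti|lei] := ltnP i (size u).
  by rewrite nth_mkseq // h.
by rewrite nth_default.
Qed.

Lemma is_cliff_leq u v : all2 leq u v -> is_cliff delta v -> is_cliff delta u.
Proof.
move=> /all2_leqP[szuv leuv] /is_cliffP cv; apply/is_cliffP => i lti.
by rewrite (leq_trans (leuv i)) // cv // -szuv.
Qed.

(** Capping the letters of [w] at values that those of [v] never exceed does
    not affect the comparison.  This is what makes the truncation in the product
    invisible to [upper_sum]. *)
Lemma all2_leq_trunc v w :
  is_cliff delta v -> all2 leq v (trunc delta w) = all2 leq v w.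
Proof.
move=> /is_cliffP cv.
apply/all2_leqP/all2_leqP => -[]; rewrite size_trunc => szvw h; split=> // i.
  by have := h i; rewrite nth_trunc leq_min => /andP[].
rewrite nth_trunc leq_min h; have [/cv //|lei] := ltnP i (size v).
by rewrite nth_default.
Qed.

End CliffOrder.

(** * The multiplicative basis *)

Section UpperSums.
Variables (K : fieldType) (delta : nat -> nat).
Local Notation C := (cliff delta).
Local Notation V := {malg K[C]}.
Local Notation letter n := 'I_(letter_bound delta n).

(** Letters are drawn from a finite alphabet that contains those of all cliffs
    of the given length; the tuples that are not cliffs contribute 0 by the
    definition of [F].  [w] is any word, so that the vanishing relations are
    the values at the words that are not cliffs. *)
Definition upper_sum (w : seq nat) : V :=
  \sum_(t : (size w).-tuple (letter (size w)) | all2 leq w (map val t))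
     F K delta (map val t).

Lemma cliff_tuple (c : C) n : size c = n ->
  exists t : n.-tuple (letter n), map val t = c :> seq nat.
Proof.
move=> szc; have szt : size [seq (inord k : letter n) | k <- c] == n.
  by rewrite size_map szc.
exists (Tuple szt); rewrite /= -map_comp -[RHS]map_id.
apply/eq_in_map => _ /(nthP 0%N)[i lti <-] /=.
rewrite inordK // ltnS (leq_trans (is_cliffP _ _ (cliffP c) _ lti)) //.
rewrite szc in lti.
exact: (leq_bigmax (F := fun i : 'I_n => delta i.+1) (Ordinal lti)).
Qed.

Lemma mcoeff_upper_sum w (c : C) : (upper_sum w)@_c = (all2 leq w c)%:R.
Proof.
rewrite /upper_sum raddf_sum /=.
case: (boolP (all2 leq w c)) => [lewc|nle]; last first.
  rewrite big1 // => t let_; rewrite mcoeffF; case: eqP => // cE.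
  by case/negP: nle; rewrite [X in all2 _ _ X]cE.
have [t tE] := cliff_tuple (esym (all2_leq_size lewc)).
rewrite (bigD1 t) /=; last by rewrite tE.
rewrite mcoeffF tE eqxx big1 ?addr0 // => t' /andP[_ nt].
rewrite mcoeffF; case: eqP => // t'E; case/negP: nt; apply/eqP/val_inj.
by apply: (inj_map val_inj); rewrite [RHS]tE.
Qed.

Lemma upper_sum_nil : upper_sum [::] = << cliff_nil delta >>.
Proof.
apply/malgP => c; rewrite mcoeff_upper_sum mcoeffU -val_eqE /= eq_sym.
by case: (cliff_word c).
Qed.

Lemma upper_sum_eq0 w : ~~ is_cliff delta w -> upper_sum w = 0.
Proof.
move=> ncw; apply/malgP => c; rewrite mcoeff_upper_sum mcoeff0.
case: (boolP (all2 leq w c)) => // /is_cliff_leq/(_ (cliffP c)).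
by rewrite (negPf ncw).
Qed.

(** The coefficient of a cliff [w] in the product is a sum over the ways to cut
    [w]; only the cut after [size u] letters can dominate [u], and there both
    comparisons together say that [w] dominates [u ++ v]. *)
Lemma upper_sum_cat u v : is_cliff delta v ->
  cliff_mul (upper_sum u) (upper_sum v) = upper_sum (u ++ v).
Proof.
move=> cv; apply/malgP => w; rewrite mcoeff_cliff_mul mcoeff_upper_sum.
rewrite all2_leq_cat.
under eq_bigr => k _ do
  rewrite !mcoeff_upper_sum /= all2_leq_trunc // -natrM mulnb.
have [szw|szw] := ltnP (size w) (size u); last first.
  rewrite (bigD1 (Ordinal (szw : (size u < (size w).+1)%N))) //= big1 ?addr0 //.
  move=> k nk; case: andP => // -[/all2_leq_size szu _]; case/negP: nk.
  by rewrite -val_eqE /= szu size_takel // -ltnS.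
rewrite big1 => [|k _]; case: andP => // -[/all2_leq_size szu _];
  by rewrite szu size_take_min ltnNge geq_minr in szw.
Qed.

(** The upper sums of cliffs span: [upper_sum c] minus [F_c] involves only
    cliffs of the same length and of larger letter sum, and this sum is bounded
    by that of the maximal cliff [max_cliff_word]. *)
Lemma upper_sum_ind (P : V -> Prop) :
    P 0 -> (forall x y, P x -> P y -> P (x + y)) ->
    (forall k x, P x -> P (k *: x)) -> (forall c : C, P (upper_sum c)) ->
  forall x, P x.
Proof.
move=> P0 PD PZ PE.
have PF (c : C) : P (F K delta c).
  have [n] := ubnP (sumn (max_cliff_word delta (size c)) - sumn c)%N.
  elim: n c => // n IH c ltn.
  have [t0 t0E] := cliff_tuple (erefl (size c)).
  have := PE c; rewrite /upper_sum (bigD1 t0) /=; last first.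
    by rewrite t0E all2_leq_refl.
  set s := \sum_(t | _) _; rewrite t0E => PFs.
  suff Ps : P s by rewrite -[F _ _ _](addrK s) -scaleN1r; apply/PD/PZ.
  rewrite /s; elim/big_ind: _ => // t /andP[lect nt].
  have [ct|nct] := boolP (is_cliff delta (map val t)); last first.
    by rewrite /F insubN.
  have := IH (Cliff ct); apply => /=.
  rewrite size_map size_tuple (leq_trans _ (ltn : (_ <= n)%N)) //.
  have lt_c : (sumn c < sumn (map val t))%N.
    apply: ltn_sumn lect _; apply: contra nt => /eqP cE; apply/eqP/val_inj.
    by apply: (inj_map val_inj); rewrite t0E.
  rewrite ltn_sub2l // (leq_trans lt_c) //.
  move: ct; rewrite is_cliffE size_map size_tuple; exact: leq_sumn.
move=> x; rewrite (monalgE x); elim/big_ind: _ => // c _.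
have -> : << x@_c *g c >> = x@_c *: F K delta c; last exact/PZ/PF.
by apply/malgP => d; rewrite mcoeffZ mcoeffF mcoeffU val_eqE eq_sym mulr_natr.
Qed.

End UpperSums.

(** * Unique factorization into primes *)

Section PrimeFactorization.
Variable delta : nat -> nat.
Implicit Types (p q : prime_cliff delta) (s t : seq (prime_cliff delta)).

Lemma concat_word_cons p s : concat_word (p :: s) =
  prime_val p ++ concat_word s.
Proof. by []. Qed.

Lemma concat_word_cat s t :
  concat_word (s ++ t) = concat_word s ++ concat_word t.
Proof. by rewrite /concat_word map_cat flatten_cat. Qed.

Lemma prime_cliff_neq_nil p : cliff_word p <> [::].
Proof. by case: p => u /= /asboolP[]. Qed.

Lemma prime_cliff_indecomposable p (v w : seq nat) :
    is_cliff delta v -> is_cliff delta w -> prime_val p = v ++ w :> seq nat ->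
  v = [::] \/ w = [::].
Proof.
by case: p => u /= /asboolP[_ h] cv cw; apply: (h (Cliff cv) (Cliff cw)).
Qed.

Lemma prime_factorization (u : cliff delta) : exists s, concat_word s = u.
Proof.
have [n] := ubnP (size u); elim: n u => // n IH u ltn.
have [u0|un0] := eqVneq (cliff_word u) [::]; first by exists [::].
have [pu|npu] := boolP `[< is_prime u >].
  by exists [:: PrimeCliff pu]; rewrite concat_word_cons cats0.
have [v [w [uE vn0 wn0]]] : exists v w : cliff delta,
    [/\ u = v ++ w :> seq nat, cliff_word v != [::] & cliff_word w != [::]].
  apply: contraPP npu => nvw; apply/negP/negPn/asboolP; split; first exact/eqP.
  move=> v w uE; have [->|vn0] := eqVneq (cliff_word v) [::]; first by left.
  have [->|wn0] := eqVneq (cliff_word w) [::]; first by right.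
  by case: nvw; exists v, w.
rewrite -!size_eq0 -!lt0n in vn0 wn0; rewrite uE size_cat in ltn *.
have [|s <-] := IH v.
  by apply: leq_trans (ltn : _ <= n)%N; rewrite -addn1 leq_add2l.
have [|t <-] := IH w.
  by apply: leq_trans (ltn : _ <= n)%N; rewrite -add1n leq_add2r.
by exists (s ++ t); rewrite concat_word_cat.
Qed.

(** The form in which valley-freeness enters: a suffix of a cliff made of whole
    prime factors is a cliff, although a suffix of a cliff need not be one. *)
Lemma prime_factor_suffix s (x : seq nat) : valley_free delta ->
  is_cliff delta (x ++ concat_word s) -> is_cliff delta (concat_word s).
Proof.
move=> vf; have := @is_cliff_catr delta (map (@prime_val delta) s) x vf.
by rewrite -map_comp.
Qed.

(** Were one leading prime a proper prefix of the other, what is left of the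
    longer one would be a prefix of the word that follows the shorter one.  That
    word is a cliff by [prime_factor_suffix], hence so are its prefixes, and the
    longer prime would decompose. *)
Lemma concat_word_inj s t : valley_free delta ->
  is_cliff delta (concat_word s) -> concat_word s = concat_word t -> s = t.
Proof.
move=> vf.
have head_size p q s' t' : is_cliff delta (concat_word (p :: s')) ->
    concat_word (p :: s') = concat_word (q :: t') -> (size q <= size p)%N.
  rewrite !concat_word_cons => /prime_factor_suffix-/(_ vf) cs' eq_pq.
  rewrite leqNgt; apply/negP => ltpq.
  have qE : q = p ++ drop (size p) q :> seq nat.
    have := congr1 (take (size p)) eq_pq.
    rewrite take_size_cat // takel_cat ?(ltnW ltpq) // => pE.
    by rewrite [X in X ++ _]pE cat_take_drop.
  have s'E : concat_word s' = drop (size p) q ++ concat_word t'.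
    have := congr1 (drop (size p)) eq_pq.
    by rewrite drop_size_cat // drop_cat ltpq.
  rewrite s'E in cs'; have cx := is_cliff_prefix cs'.
  case: (prime_cliff_indecomposable (cliffP p) cx qE) => [|x0].
    exact: prime_cliff_neq_nil.
  by move: ltpq; rewrite qE x0 cats0 ltnn.
elim: s t => [|p s IH] [|q t] // cs.
- rewrite concat_word_cons.
  by have := @prime_cliff_neq_nil q; case: (cliff_word q).
- rewrite concat_word_cons.
  by have := @prime_cliff_neq_nil p; case: (cliff_word p).
move=> eq_pq; have szpq : size p = size q.
  apply/eqP; rewrite eqn_leq (head_size p q s t) // andbT.
  by apply: (head_size q p t s); rewrite -?eq_pq.
move: cs eq_pq; rewrite !concat_word_cons => cs /eqP.
rewrite eqseq_cat // => /andP[/eqP/val_inj/val_inj-> /eqP eq_st].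
by congr (_ :: _); apply: IH eq_st; apply: prime_factor_suffix cs.
Qed.

End PrimeFactorization.

(** * The presentation *)

Section Presentation.
Variables (K : fieldType) (delta : nat -> nat) (vf : valley_free delta).
Local Notation P := (prime_cliff delta).
Local Notation Cl := (cliff_alg K vf).

Definition prime_lift : free_alg K P -> Cl :=
  free_lift (fun p : P => upper_sum K delta (cliff_word p) : Cl).
HB.instance Definition _ := GRing.LRMorphism.on prime_lift.

Lemma prod_upper_sum (s : seq P) :
  \prod_(p <- s) (upper_sum K delta (cliff_word p) : Cl) =
  upper_sum K delta (concat_word s).
Proof.
elim/last_ind: s => [|s p IH]; first by rewrite big_nil upper_sum_nil.
rewrite -cats1 big_cat big_seq1 IH concat_word_cat concat_word_cons cats0.
by rewrite [LHS]upper_sum_cat // cliffP.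
Qed.

Lemma prime_lift_free_word (s : seq P) :
  prime_lift (free_word K s) = upper_sum K delta (concat_word s).
Proof. by rewrite /prime_lift free_lift_free_word prod_upper_sum. Qed.

Lemma mcoeff_prime_lift (x : free_alg K P) (c : cliff delta) :
  mcoeff c (prime_lift x) =
  \sum_(m <- msupp x) x@_m * (all2 leq (concat_word m) c)%:R.
Proof.
rewrite /prime_lift free_liftE.
rewrite (raddf_sum (mcoeff c : {malg K[cliff delta]} -> K)) /=.
by apply: eq_bigr => m _; rewrite prod_upper_sum mcoeffZ mcoeff_upper_sum.
Qed.

Lemma prime_lift_surj (y : Cl) : exists x, prime_lift x = y.
Proof.
move: y; apply: upper_sum_ind => [|x y [a <-] [b <-]|k x [a <-]|c].
- by exists 0; rewrite raddf0.
- by exists (a + b); rewrite raddfD.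
- by exists (k *: a); rewrite linearZ.
have [s <-] := prime_factorization c.
by exists (free_word K s); rewrite prime_lift_free_word.
Qed.

(** Linear independence of the upper sums, by triangularity: the coefficient of
    [F_c] in the image of [x], for [c] the product of [s], collects the
    coefficients of [x] at the monomials whose product is dominated by [c].
    Such a product is a cliff; if it is not [c] its letter sum is smaller and
    induction applies, and if it is [c] the monomial is [s] by unique
    factorization. *)
Lemma prime_lift_coef0 (x : free_alg K P) (s : seq P) :
  prime_lift x = 0 -> is_cliff delta (concat_word s) -> x@_(FMonom s) = 0.
Proof.
move=> gx0; have [n] := ubnP (sumn (concat_word s)).
elim: n s => // n IH s ltn cs.
have := mcoeff_prime_lift x (Cliff cs); rewrite gx0 [LHS]mcoeff0 => ->.
rewrite [in LHS](monalgE x) raddf_sum /=; apply: eq_bigr => m _.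
rewrite mcoeffU; have [mE|nms] := eqVneq m (FMonom s).
  by rewrite mE all2_leq_refl mulr1.
case: (boolP (all2 _ _ _)) => [lems|_]; last by rewrite mulr0.
have cm := is_cliff_leq lems cs.
have neq : concat_word m != concat_word s.
  apply: contra nms => /eqP/(concat_word_inj vf cm) ms.
  by rewrite -[m]fmK ms.
by rewrite -[m]fmK IH ?mul0r ?mul0rn ?(leq_trans (ltn_sumn lems neq)).
Qed.

(** By [prime_lift_coef0], the monomials that survive in an element of the
    kernel are those whose word is not a cliff, that is, the generators of the
    relation space. *)
Lemma prime_lift_ker (x : free_alg K P) :
  (prime_lift x == 0) = (x \in rel_ideal K vf).
Proof.
apply/eqP/asboolP => [gx0|]; last first.
  move: x; apply: linear_span_ind => [|x y gx gy|k x [s [_ ncs ->]]].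
  - exact: raddf0.
  - by rewrite raddfD /= gx gy addr0.
  - by rewrite linearZ /= prime_lift_free_word upper_sum_eq0 ?scaler0.
rewrite (monalgE x); elim/big_ind: _ => [|y z|m _].
- exact: linear_span0.
- exact: linear_spanD.
have [cm|ncm] := boolP (is_cliff delta (concat_word m)).
  by rewrite -[m]fmK prime_lift_coef0 // monalgU0; apply: linear_span0.
exists [:: (x@_m, free_word K m)] => [p|].
  rewrite inE => /eqP-> /=; exists m; split=> // m0.
  by move: ncm; rewrite m0.
rewrite big_seq1 /= free_wordE; apply/malgP => d.
by rewrite mcoeffZ fmK !mcoeffU mulr_natr.
Qed.

End Presentation.

Theorem proposition3p2p7 (K : fieldType) (charK0 : [pchar K] =i pred0)
    (delta : nat -> nat) (vf : valley_free delta) :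
  exists f : {lrmorphism cliff_alg K vf -> quot_alg (rel_ideal K vf)},
    bijective f.
Proof.
exact: first_isomorphism (@prime_lift_surj K _ vf) (@prime_lift_ker K _ vf).
Qed.
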